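(* Let $c \geq 2$ and $n \geq 4$ be integers. Every collection of directed graphs $G_1, \ldots, G_c$ on a common set of $n$ vertices containing no rainbow $S_{1,1}$ satisfies \[\min_{1\leq i \leq c} e(G_i) \leq \left\lfloor\frac{n^2}{4}\right\rfloor.\] Moreover, this bound is sharp: for all such $c,n$ there is a collection with no rainbow $S_{1,1}$ attaining equality.
   Context: Each $G_i$ is a directed graph without loops or multiple edges on the common vertex set $V$ (for distinct $u,v$, the edges $uv$ and $vu$ may both be present); $e(G_i)$ denotes the number of directed edges of $G_i$. Think of $G_i$ as the edges of color $i$. $S_{1,1}$ is the directed path with two edges $x\to y\to z$ on three distinct vertices. The collection contains a rainbow $S_{1,1}$ if there are distinct vertices $x,y,z\in V$ and distinct indices $i\neq j$ with $xy\in E(G_i)$ and $yz\in E(G_j)$. *)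

(* Defs.v *)
From mathcomp Require Import all_boot.

Set Implicit Arguments.
Unset Strict Implicit.
Unset Printing Implicit Defensive.

Record digraph (V : finType) := Digraph {
  edge :> rel V;
  edge_irrefl : irreflexive edge
}.

Definition num_edges (V : finType) (G : digraph V) : nat :=
  #|[set p : V * V | edge G p.1 p.2]|.

(* G i is the graph of the edges of color i; the same pair may be an edge in
   several colors. *)
Definition rainbow_S11 (V : finType) (c : nat) (G : 'I_c -> digraph V) : Prop :=
  exists (x y z : V) (i j : 'I_c),
    [/\ uniq [:: x; y; z], i != j, edge (G i) x y & edge (G j) y z].

(* minn has no neutral element on nat; #|{: V * V}| bounds every num_edges, so
   for 0 < c this is the minimum over the colors. *)
Definition min_num_edges (V : finType) (c : nat) (G : 'I_c -> digraph V) : nat :=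
  \big[minn/#|{: V * V}|]_(i < c) num_edges (G i).

(* Main.v *)
Require Import Defs.
From mathcomp Require Import all_boot.
From mathcomp Require Import zify.

(** Only two colors, g and h, matter.  Without a rainbow path, a vertex v with
   an incoming g-edge and an outgoing h-edge has exactly one of each, and they
   join v to the same vertex u.  The d pairs (u, v) with g u v and h v u thus
   form a matching, and all other g-edges run from a set P to a set Q, all
   other h-edges from a set R to a set T, where P, T and the matched tails are
   disjoint, and so are R, Q and the matched heads.  So e(g) <= d + |P||Q| and
   e(h) <= d + |R||T|; if m is the minimum, then
   (m - d)^2 <= (|P||T|)(|R||Q|) <= ((n - d)^2 / 4)^2, that is
   m <= d + (n - d)^2 / 4, which is at most n^2 / 4 as n >= 4. *)

Section TwoColors.

Variable V : finType.

(** For loopless [g] and [h], [x = z] is the only way two consecutive edges can miss spanning three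
    vertices. *)
Definition no_alternating_path (g h : rel V) : Prop :=
  forall x y z, g x y -> h y z -> x = z.

Definition antiparallel (g h : rel V) : {set V * V} :=
  [set p | g p.1 p.2 && h p.2 p.1].

(** In the notation above, P and Q are the free tails and free heads of [g h]; R and T are those of
    [h g]. *)
Definition free_tails (g h : rel V) : {set V} :=
  [set x | [exists y, g x y] && ~~ [exists y, g x y && h y x]].

Definition free_heads (g h : rel V) : {set V} :=
  [set y | [exists x, g x y] && ~~ [exists x, g x y && h y x]].

Lemma card_antiparallelC (g h : rel V) :
  #|antiparallel h g| = #|antiparallel g h|.
Proof.
rewrite -(card_imset (antiparallel g h) (f := fun p => (p.2, p.1))); last first.
  by move=> [a b] [c d] [-> ->].
apply: eq_card => -[a b]; rewrite !inE /=; apply/idP/imsetP.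
  by case/andP=> hab gba; exists (b, a); rewrite ?inE /= ?gba.
by case=> -[c d]; rewrite inE /= => /andP[gcd hdc] [-> ->]; rewrite hdc.
Qed.

Lemma leq_card_edges (g h : rel V) :
  no_alternating_path g h -> no_alternating_path h g ->
  #|[set p : V * V | g p.1 p.2]|
    <= #|antiparallel g h| + #|free_tails g h| * #|free_heads g h|.
Proof.
move=> gh hg; rewrite -cardsX; apply: leq_trans (leq_card_setU _ _).
apply/subset_leq_card/subsetP => -[x y]; rewrite !inE /= => gxy.
have [//|Nhyx] := boolP (h y x); first by rewrite gxy.
rewrite gxy /=; apply/andP; split; apply/andP; split.
- by apply/existsP; exists y.
(* The path [z x y] forces [z = y], so a partner of [x] would make [(x, y)] itself antiparallel. *)
- apply/existsP => -[z /andP[gxz hzx]].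
  by rewrite -(hg _ _ _ hzx gxy) hzx in Nhyx.
- by apply/existsP; exists x.
- apply/existsP => -[z /andP[gzy hyz]].
  by rewrite (gh _ _ _ gxy hyz) hyz in Nhyx.
Qed.

Lemma leq_card_vertices (g h : rel V) :
  no_alternating_path g h -> no_alternating_path h g ->
  #|antiparallel g h| + #|free_tails g h| + #|free_heads h g| <= #|V|.
Proof.
move=> gh hg.
have fst_inj : {in antiparallel g h &, injective fst}.
  move=> [a b] [c d]; rewrite !inE /= => /andP[_ hba] /andP[gcd _] eac.
  by rewrite -eac in gcd *; rewrite (hg _ _ _ hba gcd).
rewrite -(card_in_imset fst_inj).
set E := fst @: _.
have disjET : [disjoint E & free_tails g h].
  apply/pred0P => x; apply/negbTE/negP => /andP[/imsetP[[a b]]].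
  rewrite !inE /= => ab ->; case/andP=> _ /existsP[].
  by exists b.
have disjEH : [disjoint E & free_heads h g].
  apply/pred0P => x; apply/negbTE/negP => /andP[/imsetP[[a b]]].
  rewrite !inE /= => ab ->; case/andP=> _ /existsP[].
  by exists b; rewrite andbC.
(* A vertex with an [h]-edge in and a [g]-edge out is a matched tail, hence not free. *)
have disjTH : [disjoint free_tails g h & free_heads h g].
  apply/pred0P => x; apply/negbTE/negP => /andP[]; rewrite !inE.
  case/andP=> /existsP[y gxy] /existsP Nx /andP[/existsP[z hzx] _].
  by apply: Nx; exists y; rewrite gxy -(hg _ _ _ hzx gxy).
have /eqP <- : #|E :|: free_tails g h| == #|E| + #|free_tails g h|.
  by rewrite (leq_card_setU _ _).2.
have /eqP <- : #|E :|: free_tails g h :|: free_heads h g|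
    == #|E :|: free_tails g h| + #|free_heads h g|.
  by rewrite (leq_card_setU _ _).2 disjoints_subset subUset -!disjoints_subset
    disjEH.
exact: max_card.
Qed.

End TwoColors.

Lemma four_mul_leq_sqr (a b k : nat) : a + b <= k -> 4 * (a * b) <= k ^ 2.
Proof.
by move=> abk; apply: leq_trans (nat_AGM2 a b) _; rewrite leq_sqr.
Qed.

(** The factors are regrouped across colors because only P, T and R, Q are known to be disjoint. *)
Lemma leq_quarter_sqr (n d p q r t m : nat) :
  4 <= n -> d + p + t <= n -> d + r + q <= n ->
  m <= d + p * q -> m <= d + r * t -> m <= n ^ 2 %/ 4.
Proof.
move=> n4 dpt drq mpq mrt; rewrite leq_divRL //.
have pt : 4 * (p * t) <= (n - d) ^ 2 by apply: four_mul_leq_sqr; lia.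
have rq : 4 * (r * q) <= (n - d) ^ 2 by apply: four_mul_leq_sqr; lia.
have md : 4 * (m - d) <= (n - d) ^ 2.
  rewrite -leq_sqr; apply: leq_trans (leq_mul pt rq).
  have := @leq_mul (m - d) (p * q) (m - d) (r * t); nia.
(* Here [4 * d <= n * d <= n ^ 2 - (n - d) ^ 2], as [d <= n]. *)
nia.
Qed.

Lemma bigminn_leq (I : eqType) (s : seq I) (k : nat) (F : I -> nat) (i : I) :
  i \in s -> \big[minn/k]_(j <- s) F j <= F i.
Proof.
elim: s => // a s IHs; rewrite inE big_cons geq_min => /orP[/eqP-> | /IHs->].
  by rewrite leqnn.
by rewrite orbT.
Qed.

Lemma min_num_edges_leq (V : finType) (c : nat) (G : 'I_c -> digraph V)
    (i : 'I_c) : min_num_edges G <= num_edges (G i).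
Proof. by apply: bigminn_leq; rewrite mem_index_enum. Qed.

Lemma min_num_edges_const (V : finType) (c : nat) (G : digraph V) :
  0 < c -> min_num_edges (fun _ : 'I_c => G) = num_edges G.
Proof.
move=> c_gt0; apply/eqP; rewrite eqn_leq.
rewrite (min_num_edges_leq _ _ (fun _ => G) (Ordinal c_gt0)) /=.
(* The default value is harmless: no edge set exceeds [V * V]. *)
rewrite /min_num_edges; elim/big_rec: _ => [|i m _ lem]; first exact: max_card.
by rewrite leq_min leqnn.
Qed.

Lemma no_rainbow_no_alternating_path (V : finType) (c : nat)
    (G : 'I_c -> digraph V) (i j : 'I_c) :
  ~ rainbow_S11 G -> i != j -> no_alternating_path V (edge (G i)) (edge (G j)).
Proof.
move=> noG ij x y z Gxy Gyz; apply/eqP/negPn/negP => xz; apply: noG.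
exists x, y, z, i, j; split=> //=; rewrite !inE negb_or xz !andbT.
apply/andP; split; apply: contraTneq isT => e.
  by rewrite e edge_irrefl in Gxy.
by rewrite e edge_irrefl in Gyz.
Qed.

(** A complete bipartite graph with all edges directed one way: no head is a tail, so no two edges
    are consecutive. *)
Definition cut_rel (n k : nat) : rel 'I_n := fun x y => x < k <= y.

Lemma cut_rel_irrefl (n k : nat) : irreflexive (cut_rel n k).
Proof. by move=> x; rewrite /cut_rel; lia. Qed.

Definition cut_digraph (n k : nat) : digraph 'I_n :=
  Digraph (cut_rel_irrefl n k).

Lemma num_edges_cut_digraph (n k : nat) :
  k <= n -> num_edges (cut_digraph n k) = k * (n - k).
Proof.
move=> kn; pose A := [set x : 'I_n | x < k].
have cardA : #|A| = k.
  by rewrite cardsE -sum1_card (big_ord_narrow kn) sum1_card card_ord.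
have -> : num_edges (cut_digraph n k) = #|setX A (~: A)|.
  by apply: eq_card => -[x y]; rewrite !inE /= /cut_rel -leqNgt.
by rewrite cardsX [#|~: A|]cardsCs setCK cardA card_ord.
Qed.

Theorem theorem6 (c n : nat) (hc : 2 <= c) (hn : 4 <= n) :
  (forall (V : finType) (G : 'I_c -> digraph V),
     #|V| = n -> ~ rainbow_S11 G -> min_num_edges G <= n ^ 2 %/ 4)
  /\
  (exists (V : finType) (G : 'I_c -> digraph V),
     [/\ #|V| = n, ~ rainbow_S11 G & min_num_edges G = n ^ 2 %/ 4]).
Proof.
split=> [V G cardV noG|].
  pose i := Ordinal (ltnW hc); pose j := Ordinal hc.
  have ij := no_rainbow_no_alternating_path V c G i j noG isT.
  have ji := no_rainbow_no_alternating_path V c G j i noG isT.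
  have ei := leq_card_edges V _ _ ij ji.
  have ej := leq_card_edges V _ _ ji ij.
  have vi := leq_card_vertices V _ _ ij ji.
  have vj := leq_card_vertices V _ _ ji ij.
  (* Both orders of the two colors yield the same matching size [d]. *)
  rewrite card_antiparallelC in ej vj; rewrite cardV in vi vj.
  exact: (leq_quarter_sqr _ _ _ _ _ _ _ hn vi vj (leq_trans (min_num_edges_leq _ _ G i) ei)
    (leq_trans (min_num_edges_leq _ _ G j) ej)).
(* All colors share the balanced cut, whose two sides have product [n ^ 2 %/ 4]. *)
exists 'I_n, (fun=> cut_digraph n (n %/ 2)); split; first exact: card_ord.
  by case=> x [y [z [i [j [_ _ /andP[_ ky] /andP[yk _]]]]]]; lia.
rewrite min_num_edges_const ?num_edges_cut_digraph //; [nia|lia|lia].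
Qed.
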